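(* Let $n_x\ge 1$ and $n_{\mathcal F}\ge 1$ be integers and let $\mathrm{Pr}_{\mathbb W}$ be a probability distribution on $\mathbb R^{n_x}\times\mathbb R$, the distribution of a random vector $w=(x,y)$. Consider a finite family of (fixed, i.e. not depending on the samples below) candidate estimators $$\mathcal F=\{(T_j(\cdot),\hat\sigma_j(\cdot)) : j\in\{1,\dots,n_{\mathcal F}\}\},$$ where $T_j:\mathbb R^{n_x}\to\mathbb R$ and $\hat\sigma_j:\mathbb R^{n_x}\to(0,\infty)$ are measurable for every $j$. Let $\varepsilon\in(0,1)$, $\delta\in(0,1)$, let $r\ge 1$ be an integer, and let $N\ge r$ be an integer such that $$\sum_{i=0}^{r-1}\binom{N}{i}\varepsilon^i(1-\varepsilon)^{N-i}\le \frac{\delta}{n_{\mathcal F}}.$$ Draw $N$ i.i.d. samples $\{(x_i,y_i)\}_{i=1}^N$ from $\mathrm{Pr}_{\mathbb W}$ and set $$\bar\gamma_j = \mathrm{max}^{(r)}\left\{\frac{|y_i-T_j(x_i)|}{\hat\sigma_j(x_i)}\right\}_{i=1}^N,\qquad j\in\{1,\dots,n_{\mathcal F}\}.$$ Then, with probability no smaller than $1-\delta$ with respect to the draw of the $N$ samples, it holds simultaneously for all $j\in\{1,\dots,n_{\mathcal F}\}$ that $$\mathrm{Pr}_{\mathbb W}\{|y-T_j(x)|>\bar\gamma_j\,\hat\sigma_j(x)\}\le\varepsilon.$$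
   Context: Generalized max: for a collection of $N$ scalars $\{q_i\}_{i=1}^N$ (counted with multiplicity) and an integer $1\le r\le N$, $\mathrm{max}^{(r)}\{q_i\}_{i=1}^N$ denotes the $r$-th largest value of the collection: $\mathrm{max}^{(1)}$ is the largest value, $\mathrm{max}^{(2)}$ the second largest, and so on, with $\mathrm{max}^{(N)}$ the smallest. In particular, no more than $r-1$ elements are strictly larger than it. The samples are i.i.d. with law $\mathrm{Pr}_{\mathbb W}$, so ''with probability no smaller than $1-\delta$'' refers to the product measure $\mathrm{Pr}_{\mathbb W}^{\otimes N}$ on the multisample. In the inner probability $\mathrm{Pr}_{\mathbb W}\{\cdot\}$, $(x,y)$ is a fresh random vector with law $\mathrm{Pr}_{\mathbb W}$ and the values $\bar\gamma_j$ are held fixed. *)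

(* Defs.v *)
From HB Require Import structures.
From mathcomp Require Import all_boot all_order all_algebra.
From mathcomp Require Import all_classical all_reals all_analysis.

Set Implicit Arguments.
Unset Strict Implicit.
Unset Printing Implicit Defensive.
Import Order.TTheory GRing.Theory Num.Theory.
Import numFieldNormedType.Exports.

Local Open Scope classical_set_scope.
Local Open Scope ring_scope.

(* [r] counts from 1; the default 0 is only reached when [r > size s]. *)
Definition rth_max (R : realType) (r : nat) (s : seq R) : R :=
  nth 0 (sort >=%R s) r.-1.

Section product_power.
Context d (T : measurableType d) (R : realType).
Implicit Types P : probability T R.

Definition tuple_cons n (p : T * n.-tuple T) : n.+1.-tuple T :=
  [tuple of p.1 :: p.2].

Lemma measurable_tuple_cons n :
  measurable_fun [set: T * n.-tuple T] (@tuple_cons n).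
Proof. exact: (measurable_cons measurable_fst measurable_snd). Qed.

HB.instance Definition _ n := isMeasurableFun.Build _ _ _ _
  (@tuple_cons n) (@measurable_tuple_cons n).

(* The n-fold product measure on the product sigma-algebra of [n.-tuple T]. *)
Fixpoint product_power P (n : nat) : probability (n.-tuple T) R :=
  if n is m.+1 then distribution (P \x product_power P m)%E (@tuple_cons m)
  else dirac [tuple].

Lemma product_power_box P n (A : 'I_n -> set T) :
  (forall i, measurable (A i)) ->
  product_power P n [set t | forall i, A i (tnth t i)] = (\prod_i P (A i))%E.
Proof.
elim: n A => [|n IHn] A mA.
  rewrite big_ord0 /= diracE mem_set//=; first by case.
rewrite big_ord_recl -(IHn (fun i => A (lift ord0 i)))// -product_measure1E//.
- congr (product_measure1 _ _ _); apply/seteqP; split=> -[x t] /=.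
    move=> At; split=> [|i]; first exact: (At ord0).
    by have := At (lift ord0 i); rewrite tnthS.
  move=> [Ax At] i; case: (unliftP ord0 i) => [j|] ->; last exact: Ax.
  by rewrite tnthS.
- rewrite [X in measurable X](_ : _ =
    \bigcap_(i in [set: 'I_n]) ((@tnth _ _)^~ i @^-1` A (lift ord0 i))); last first.
    by apply/seteqP; split=> t /= At i => [_|]; exact: At.
  apply: fin_bigcap_measurable; first exact: finite_finset.
  move=> i _; rewrite -[X in measurable X]setTI.
  exact: measurable_tnth.
Qed.

End product_power.

(* Main.v *)
(* For a score q = |y - T x| / sigma x let a be the least t such that
   P(q > t) <= eps.  Then P(q >= a) >= eps even when q has atoms, and the
   guarantee fails for a sample exactly when its r-th largest score is < a,
   that is, when fewer than r of the N scores are >= a.  Since P(q >= a) >= eps,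
   this has probability at most that of fewer than r successes in N Bernoulli
   trials of parameter eps; a union bound over the estimators concludes. *)
From HB Require Import structures.
Require Import Defs.
From mathcomp Require Import all_boot all_order all_algebra.
From mathcomp Require Import all_classical all_reals all_analysis.
From mathcomp Require Import measurable_realfun.
From mathcomp Require Import ring lra.
Import Order.TTheory GRing.Theory Num.Theory.
Import numFieldNormedType.Exports.

Local Open Scope classical_set_scope.
Local Open Scope ring_scope.

(** In a nonincreasing list the entries [>= a] form an initial segment, so index [k] falls in it
    exactly when its length exceeds [k]. *)
Lemma sorted_ge_nth (R : realType) (a : R) (s : seq R) (k : nat) :
  sorted >=%R s -> (k < size s)%N ->
  (a <= nth 0 s k) = (k < count (>= a) s)%N.
Proof.
elim: s k => [//|x s IHs] k /= xs ks.
have [ax|xa] := leP a x.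
  case: k ks => [//|k] ks; rewrite /= add1n ltnS; apply: IHs => //.
  exact: path_sorted xs.
have all_lt : all (< a) (x :: s).
  rewrite /= xa; apply/allP => y ys.
  have := order_path_min (rev_trans le_trans) xs.
  by move=> /allP/(_ y ys) /= yx; exact: le_lt_trans xa.
rewrite add0n (_ : count _ s = 0%N); last first.
  apply/eqP; rewrite -leqn0 leqNgt -has_count; apply/hasPn => y ys.
  by rewrite /= -ltNge; move/allP: all_lt; apply; rewrite inE ys orbT.
rewrite ltn0; apply/negbTE; rewrite -ltNge.
by move/allP: all_lt; apply; exact: (@mem_nth _ 0 (x :: s)).
Qed.

(** Sorting preserves counts, and [r <= size s] keeps the default value of [nth] out of play. *)
Lemma le_rth_max (R : realType) (a : R) (r : nat) (s : seq R) :
  (0 < r <= size s)%N -> (a <= rth_max r s) = (r <= count (>= a) s)%N.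
Proof.
case: r => [//|r] /= rs.
rewrite /rth_max /= sorted_ge_nth ?size_sort// ?count_sort//.
by apply: sort_sorted => x y; rewrite /= le_total.
Qed.

(** Probability of fewer than [r] successes in [N] Bernoulli trials of parameter [p]. *)
Definition binomial_lt {R : realType} (N r : nat) (p : R) : R :=
  \sum_(0 <= i < r) 'C(N, i)%:R * p ^+ i * (1 - p) ^+ (N - i).

(** Conditioning on the first trial; termwise this is Pascal's rule. *)
Lemma binomial_ltSS (R : realType) (N r : nat) (p : R) :
  binomial_lt N.+1 r.+1 p =
  p * binomial_lt N r p + (1 - p) * binomial_lt N r.+1 p.
Proof.
rewrite /binomial_lt big_nat_recl// [in RHS]big_nat_recl// !bin0 !subn0 !expr0.
rewrite mulrDr addrCA exprS; congr (_ + _); first by rewrite !mul1r.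
rewrite !mulr_sumr -big_split /=; apply: eq_bigr => i _.
rewrite binS natrD subSS.
(* For [N <= i] the truncated exponents no longer match, but ['C(N, i.+1)] vanishes. *)
have [iN|Ni] := ltnP i N; last by rewrite bin_small// exprS; ring.
by rewrite -(@prednK (N - i)%N) ?subn_gt0// -subnS !exprS; ring.
Qed.

Lemma binomial_lt0S (R : realType) (r : nat) (p : R) :
  binomial_lt 0 r.+1 p = 1.
Proof.
rewrite /binomial_lt big_nat_recl// bin0 !expr0 !mul1r big1 ?addr0// => i _.
by rewrite bin0n !mul0r.
Qed.

Lemma binomial_lt_leS (R : realType) (N r : nat) (p : R) :
  0 <= p <= 1 -> binomial_lt N r p <= binomial_lt N r.+1 p.
Proof.
move=> /andP[p0 p1]; rewrite /binomial_lt big_nat_recr//= lerDl.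
by rewrite !mulr_ge0// exprn_ge0// subr_ge0.
Qed.

Section count_in.
Context d (T : measurableType d) (R : realType).

Lemma measurable_count_lt (A : set T) n (r : nat) : measurable A ->
  measurable [set t : n.-tuple T | (count (mem A) t < r)%N].
Proof.
move=> mA.
(* The count as a real sum of indicators, measurable term by term. *)
pose f (t : n.-tuple T) : R := \sum_(i < n) \1_A (tnth t i).
have mf : measurable_fun setT f.
  apply: measurable_sum => i.
  apply: (@measurableT_comp _ _ _ _ _ _ (\1_A : T -> R)).
    exact: measurable_indic.
  exact: measurable_tnth.
rewrite (_ : mkset _ = setT `&` f @^-1` `]-oo, r%:R[).
  exact: mf.
apply/seteqP; rewrite setTI.
have fE t : f t = (count (mem A) t)%:R.
  rewrite -sum1_count big_mkcond /= natr_sum big_tuple.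
  by apply: eq_bigr => i _; rewrite indicE; case: (_ \in _).
by split=> t /=; rewrite in_itv/= fE ltr_nat.
Qed.

(* Conditioning on the first sample gives the recursion [binomial_ltSS], with
   [q := P A] in place of [p]; as [binomial_lt] is nondecreasing in [r], lowering
   the weight from [q] to [p] only increases the convex combination. *)
Lemma product_power_count_lt (P : probability T R) (A : set T) (p : R) :
  measurable A -> 0 <= p -> (p%:E <= P A)%E -> forall n r,
  (product_power P n [set t | (count (mem A) t < r)%N]
   <= (binomial_lt n r p)%:E)%E.
Proof.
move=> mA p0 pA.
have lt0 n : (product_power P n [set t | (count (mem A) t < 0)%N]
    <= (binomial_lt n 0 p)%:E)%E.
  rewrite (_ : mkset _ = set0); first by rewrite measure0 /binomial_lt big_geq.
  by apply/seteqP; split.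
elim=> [|n IHn] [|r].
- exact: lt0.
- by rewrite binomial_lt0S; apply: probability_le1; exact: measurable_count_lt.
- exact: lt0.
pose C r := [set t : n.-tuple T | (count (mem A) t < r)%N].
have mC k : measurable (C k) by exact: measurable_count_lt.
have CS : product_power P n.+1 [set t | (count (mem A) t < r.+1)%N] =
    (P A * product_power P n (C r) +
     (1 - P A) * product_power P n (C r.+1))%E.
  rewrite -probability_setC//.
  rewrite /= /distribution /pushforward.
  (* Splitting on whether the first sample lies in [A] gives two disjoint rectangles. *)
  rewrite (_ : _ @^-1` _ = (A `*` C r) `|` (~` A `*` C r.+1)); last first.
    apply/seteqP; split=> -[x t] /=; have [xA|xA] := pselect (A x).
    + by rewrite mem_set// add1n => ?; left.
    + by rewrite memNset// => ?; right.
    + by rewrite mem_set// add1n => -[[]|[]].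
    + by rewrite memNset// => -[[]|[]].
  have mCA := measurableC mA.
  rewrite measureU; last 3 first.
  - exact: measurableX.
  - exact: measurableX.
  - by apply/seteqP; split=> // -[x t] [[/= ? _] []].
  by congr (_ + _)%E; exact: product_measure1E.
rewrite CS binomial_ltSS.
have := IHn r; have := IHn r.+1; rewrite -!/(C _).
have := probability_le1 P mA; move: pA.
rewrite -(fineK (fin_num_measure P A mA)).
rewrite -(fineK (fin_num_measure (product_power P n) _ (mC r))).
rewrite -(fineK (fin_num_measure (product_power P n) _ (mC r.+1))).
rewrite -EFinB -!EFinM -EFinD !lee_fin.
set q := fine (P A); move=> pq q1 Fr1 Fr.
have p01 : 0 <= p <= 1 by rewrite p0 (le_trans pq).
have FS := binomial_lt_leS _ n r _ p01.
have q0 : 0 <= q by exact: le_trans pq.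
apply: (@le_trans _ _ (q * binomial_lt n r p + (1 - q) * binomial_lt n r.+1 p)).
  by rewrite lerD// ler_wpM2l// subr_ge0.
(* The difference of the two sides is [(q - p) * (binomial_lt n r.+1 p - binomial_lt n r p)], a
   product of nonnegative factors. *)
by nra.
Qed.

End count_in.

(** The witness is the infimum of the levels [t] with [P(X > t) <= p]; monotonicity and right
    continuity of [ccdf] make these levels a closed half-line. *)
Lemma quantile_ccdf d (T : measurableType d) (R : realType)
  (P : probability T R) (X : {RV P >-> R}) (p : R) : 0 < p < 1 ->
  exists a : R, (p%:E <= P [set w | (a <= X w)%R])%E /\
    forall t, (ccdf X t <= p%:E)%E = (a <= t).
Proof.
move=> /andP[p0 p1].
pose S := [set t | (ccdf X t <= p%:E)%E].
(* The limits of [ccdf] at both infinities, with [0 < p < 1], make [S] nonempty and bounded below,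
   so that [inf S] is a true infimum. *)
have S0 : S !=set0.
  apply: contrapT => /set0P/negP; rewrite negbK => /eqP S0.
  have : (p%:E <= 0)%E.
    apply: cvge_ge (cvg_ccdfy0 X); near=> t.
    by rewrite leNgt; apply/negP => /ltW tS; have : S t by []; rewrite S0.
  by rewrite leNgt lte_fin p0.
have lbS t : (p%:E < ccdf X t)%E -> lbound S t.
  move=> pt s; rewrite /S /= => sp; rewrite leNgt; apply/negP => st.
  have := ccdf_nonincreasing X (ltW st).
  by rewrite leNgt (le_lt_trans sp pt).
have hlS : has_lbound S.
  apply: contrapT => nlS.
  have : (1 <= p%:E)%E.
    apply: cvge_le (cvg_ccdfNy1 X); near=> t.
    by rewrite leNgt; apply/negP => /lbS ?; apply: nlS; exists t.
  by rewrite leNgt lte_fin p1.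
pose a := inf S.
have gt_a t : a < t -> (ccdf X t <= p%:E)%E.
  move=> at_; rewrite leNgt; apply/negP => /lbS/(lb_le_inf S0).
  by rewrite leNgt at_.
have Sa : (ccdf X a <= p%:E)%E.
  apply: cvge_le (@ccdf_right_continuous _ _ _ _ X a).
  by near=> t; apply: gt_a; near: t; exact: nbhs_right_gt.
exists a; split; last first.
  move=> t; apply/idP/idP => [tS|]; first exact: ge_inf.
  by rewrite le_eqVlt => /predU1P[<-//|]; exact: gt_a.
(* The event [a <= X] is the decreasing limit of the [F n], each of probability above [p] because
   its level lies below [inf S]. *)
pose F n := X @^-1` `]a - n.+1%:R^-1, +oo[.
rewrite (_ : mkset _ = \bigcap_n F n); last first.
  rewrite /F -preimage_bigcap -itvcyEbigcap.
  by apply/seteqP; split=> w /=; rewrite in_itv/= andbT.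
apply: (@cvge_ge _ \oo _ _ (P \o F)); last first.
  apply: nonincreasing_cvg_mu => [| | |m n mn].
  - by rewrite -ge0_fin_numE// fin_num_measure//; exact: measurable_funPTI.
  - by move=> ?; exact: measurable_funPTI.
  - by apply: bigcap_measurable => // ? _; exact: measurable_funPTI.
  - apply/subsetPset => w; rewrite /F /= !in_itv/= !andbT.
    apply: le_lt_trans; rewrite lerB// lef_pV2 ?posrE// ler_nat ltnS//.
near=> n.
rewrite leNgt; apply/negP => /ltW /(ge_inf hlS).
by rewrite leNgt ltrBlDr ltrDl invr_gt0 ltr0n.
Unshelve. all: by end_near. Qed.

Theorem theorem4p1 (R : realType) (nx nF : nat)
  (hnx : (1 <= nx)%N) (hnF : (1 <= nF)%N)
  (PW : probability (nx.-tuple R * R)%type R)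
  (T sigma : 'I_nF -> nx.-tuple R -> R)
  (mT : forall j, measurable_fun [set: nx.-tuple R] (T j))
  (msigma : forall j, measurable_fun [set: nx.-tuple R] (sigma j))
  (sigma_gt0 : forall j x, 0 < sigma j x)
  (eps delta : R) (heps : 0 < eps < 1) (hdelta : 0 < delta < 1)
  (r N : nat) (hr : (1 <= r)%N) (hN : (r <= N)%N)
  (hbinom : \sum_(0 <= i < r) 'C(N, i)%:R * eps ^+ i * (1 - eps) ^+ (N - i)
            <= delta / nF%:R) :
  let gamma (s : N.-tuple (nx.-tuple R * R)) (j : 'I_nF) : R :=
    rth_max r [seq `|p.2 - T j p.1| / sigma j p.1 | p <- s] in
  ((1 - delta)%:E <=
   product_power PW N
     [set s | forall j : 'I_nF,
        PW [set p | (gamma s j * sigma j p.1 < `|p.2 - T j p.1|)%R]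
        <= eps%:E])%E.
Proof.
cbv zeta.
set gamma := fun (s : N.-tuple (nx.-tuple R * R)) (j : 'I_nF) => rth_max r _.
pose X j (w : nx.-tuple R * R) : R := `|w.2 - T j w.1| / sigma j w.1.
have mX j : measurable_fun setT (X j).
  apply: measurable_funM.
    apply: measurableT_comp => //; apply: measurable_funB => //.
    exact: measurableT_comp.
  (* As [sigma j] is positive, its inverse is the real power of exponent [-1], a measurable
     function. *)
  apply: (eq_measurable_fun (fun w : nx.-tuple R * R => sigma j w.1 `^ (-1))).
    by move=> w _; rewrite powR_inv1// ltW.
  by apply: (measurableT_comp (measurable_powR (-1))); exact: measurableT_comp.
pose rX j : {RV PW >-> R} :=
  HB.pack (X j) (isMeasurableFun.Build _ _ _ _ (X j) (mX j)).
have /(_ _)/cid-/all_sig[a ha] := fun j => quantile_ccdf _ _ _ _ (rX j) _ heps.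
pose A j := [set w | a j <= X j w].
have mA j : measurable (A j).
  rewrite (_ : A j = X j @^-1` `[a j, +oo[); last first.
    by apply/seteqP; split=> w /=; rewrite in_itv/= andbT.
  by rewrite -[X in measurable X]setTI; exact: (mX j).
pose B j := [set s : N.-tuple (nx.-tuple R * R) | (count (mem (A j)) s < r)%N].
have mB j : measurable (B j) by exact: measurable_count_lt.
rewrite (_ : mkset _ = ~` \big[setU/set0]_(j < nF) B j); last first.
  (* Dividing by [sigma j] turns the risk into [ccdf] of the score at [gamma s j]; it is at most
     [eps] iff [a j <= gamma s j], which is a count by [le_rth_max]. *)
  have goodE s j : (PW [set p | (gamma s j * sigma j p.1 < `|p.2 - T j p.1|)%R]
      <= eps%:E)%E = (r <= count (mem (A j)) s)%N.
    rewrite (_ : mkset _ = X j @^-1` `]gamma s j, +oo[); last first.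
      by apply/seteqP; split=> w /=; rewrite in_itv/= andbT /X ltr_pdivlMr.
    have [_] := ha j; rewrite /ccdf/= => ->.
    rewrite le_rth_max ?size_map ?size_tuple ?hr// count_map.
    congr leq; apply: eq_count => w /=; rewrite /A.
    by apply/idP/idP; rewrite inE.
  rewrite -bigcup_seq; apply/seteqP; split=> s /=.
    by move=> h [j _]; rewrite /B /= ltnNge -goodE h.
  move=> h j; rewrite goodE leqNgt; apply/negP => sj; apply: h; exists j => //.
  exact: mem_index_enum.
have mU : measurable (\big[setU/set0]_(j < nF) B j).
  by apply: bigsetU_measurable.
rewrite probability_setC// EFinB leeB//.
apply: (@le_trans _ _ (\sum_(j < nF) product_power PW N (B j))%E).
  (* The induction for the union bound carries measurability along, as subadditivity requires it. *)
  pose K U x := measurable U /\ (product_power PW N U <= x)%E.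
  apply: (proj2 (big_ind2 K _ _ _ )) => //; first by split; rewrite ?measure0.
  move=> U x V y [mU1 Ux] [mV Vy]; split; first exact: measurableU.
  by apply: (le_trans (measureU2 _ mU1 mV)); exact: leeD.
apply: (@le_trans _ _ (\sum_(j < nF) (delta / nF%:R)%:E)%E).
  apply: lee_sum => j _.
  have [pA _] := ha j.
  apply: (@le_trans _ _ (binomial_lt N r eps)%:E); last by rewrite lee_fin.
  apply: product_power_count_lt => //; first by case/andP: heps => /ltW.
rewrite sumEFin lee_fin sumr_const card_ord -[X in X <= _]mulr_natr divfK//.
by rewrite pnatr_eq0 -lt0n.
Qed.
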